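(* Let $\mathfrak{su}(3,3)=\{X\in\mathfrak{sl}(6,\mathbb C): X+\sigma X^*\sigma=0\}$, where $X^*$ is the conjugate transpose of $X$ and $\sigma$ is the $6\times6$ matrix with entries $\sigma_{k\ell}=1$ if $k+\ell=7$ and $0$ otherwise. Let $\mathfrak{sl}(6,\mathbb C)=\mathfrak g_{-2}\oplus\cdots\oplus\mathfrak g_2$ be the $|2|$-grading determined by $\Sigma_{2,4}=\{\alpha_2,\alpha_4\}$, and let $\mathfrak n_{-k}=\mathfrak g_{-k}\cap\mathfrak{su}(3,3)$ for $k=1,2$. Then the real graded 2-step nilpotent Lie algebra $\mathfrak n_{-2}\oplus\mathfrak n_{-1}$ is isomorphic to the pseudo $H$-type algebra $\mathfrak n^{1,3}$, with $\mathfrak n_{-1}$ as the minimal admissible module of $\mathrm{Cl}(\mathfrak n_{-2},\langle\cdot,\cdot\rangle_{\mathfrak n_{-2}})$, where $\langle\cdot,\cdot\rangle_{\mathfrak n_{-2}}$ is a scalar product of signature $(1,3)$.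
   Context: The grading of $\mathfrak{sl}(6,\mathbb C)$ determined by $\Sigma_{2,4}$ is the block grading for the partition of the indices $\{1,\dots,6\}$ into $\{1,2\},\{3,4\},\{5,6\}$: with $E_{k\ell}$ the elementary matrices, $\mathfrak g_{-1}=\mathrm{span}_{\mathbb C}\{E_{k\ell}: k\in\{3,4\},\ell\in\{1,2\}\ \text{or}\ k\in\{5,6\},\ell\in\{3,4\}\}$ and $\mathfrak g_{-2}=\mathrm{span}_{\mathbb C}\{E_{k\ell}: k\in\{5,6\},\ell\in\{1,2\}\}$. A pseudo $H$-type Lie algebra is a real graded 2-step nilpotent Lie algebra $\mathfrak n=\mathfrak n_{-2}\oplus\mathfrak n_{-1}$ (with $[\mathfrak n_{-1},\mathfrak n_{-1}]\subset\mathfrak n_{-2}$ and $\mathfrak n_{-2}$ central) endowed with a non-degenerate symmetric bilinear form $\langle\cdot,\cdot\rangle=\langle\cdot,\cdot\rangle_{\mathfrak n_{-2}}+\langle\cdot,\cdot\rangle_{\mathfrak n_{-1}}$ with $\langle\cdot,\cdot\rangle_{\mathfrak n_{-2}}$ non-degenerate, such that the maps $J_z\in\mathrm{End}(\mathfrak n_{-1})$, $z\in\mathfrak n_{-2}$, defined by $\langle J_zx,y\rangle_{\mathfrak n_{-1}}=\langle[x,y],z\rangle_{\mathfrak n_{-2}}$ for all $x,y\in\mathfrak n_{-1}$ satisfy $J_z^2=-\langle z,z\rangle_{\mathfrak n_{-2}}\mathrm{Id}_{\mathfrak n_{-1}}$. Then $J$ extends to a representation of the Clifford algebra $\mathrm{Cl}(\mathfrak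 n_{-2},\langle\cdot,\cdot\rangle_{\mathfrak n_{-2}})$ (with the convention $z^2=-\langle z,z\rangle$). A real Clifford module $\tilde J:\mathrm{Cl}(\mathfrak n_{-2},\langle\cdot,\cdot\rangle_{\mathfrak n_{-2}})\to\mathrm{End}(V)$ is admissible if $V$ carries a non-degenerate symmetric bilinear form $\langle\cdot,\cdot\rangle_V$ with $\langle\tilde J_zx,y\rangle_V=-\langle x,\tilde J_zy\rangle_V$ for all $z\in\mathfrak n_{-2}$, $x,y\in V$; it is minimal admissible if it is admissible of minimal dimension. Signature $(r,s)$ means $r$ positive and $s$ negative eigenvalues, and $\mathfrak n^{r,s}$ denotes the pseudo $H$-type algebra $\mathfrak n_{-2}\oplus\mathfrak n_{-1}$ for which $\langle\cdot,\cdot\rangle_{\mathfrak n_{-2}}$ has signature $(r,s)$ and $\mathfrak n_{-1}$ is a minimal admissible module of $\mathrm{Cl}(\mathfrak n_{-2},\langle\cdot,\cdot\rangle_{\mathfrak n_{-2}})$. *)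

(* Defs.v *)
From HB Require Import structures.
From mathcomp Require Import all_boot all_order all_algebra.
From mathcomp Require Import sesquilinear spectral generic_quotient.
From mathcomp Require Import boolp zify ring.
From mathcomp.real_closed Require Import complex.

Set Implicit Arguments.
Unset Strict Implicit.
Unset Printing Implicit Defensive.

Import Order.TTheory GRing.Theory Num.Theory.
Local Open Scope ring_scope.
Local Open Scope quotient_scope.

(* The Clifford algebra Cl(W, q) is the associative unital R-algebra generated
   by the R-module W subject to z * z = - q z: expressions in the generators
   modulo the congruence [cleq] generated by the algebra axioms, the linearity
   of W -> Cl and the Clifford relation. The algebra types of MathComp presume
   1 != 0; here Cl is only a [pzRingType] and an [lmodType R], and
   [cl_scaleAl], [cl_scaleAr] make it an algebra. *)
Section Clifford.
Variables (R : comPzRingType) (W : lmodType R).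

Inductive clterm :=
  | ClGen of W
  | ClScal of R
  | ClAdd of clterm & clterm
  | ClMul of clterm & clterm.

HB.instance Definition _ := gen_eqMixin clterm.
HB.instance Definition _ := gen_choiceMixin clterm.

Variable q : W -> R.

Inductive cleq : clterm -> clterm -> Prop :=
  | cleq_refl t : cleq t t
  | cleq_sym t u : cleq t u -> cleq u t
  | cleq_trans t u v : cleq t u -> cleq u v -> cleq t v
  | cleq_add t t' u u' :
      cleq t t' -> cleq u u' -> cleq (ClAdd t u) (ClAdd t' u')
  | cleq_mul t t' u u' :
      cleq t t' -> cleq u u' -> cleq (ClMul t u) (ClMul t' u')
  | cleq_addA t u v : cleq (ClAdd t (ClAdd u v)) (ClAdd (ClAdd t u) v)
  | cleq_addC t u : cleq (ClAdd t u) (ClAdd u t)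
  | cleq_add0 t : cleq (ClAdd (ClScal 0) t) t
  | cleq_addN t : cleq (ClAdd (ClMul (ClScal (-1)) t) t) (ClScal 0)
  | cleq_mulA t u v : cleq (ClMul t (ClMul u v)) (ClMul (ClMul t u) v)
  | cleq_mul1 t : cleq (ClMul (ClScal 1) t) t
  | cleq_mulDl t u v :
      cleq (ClMul (ClAdd t u) v) (ClAdd (ClMul t v) (ClMul u v))
  | cleq_mulDr t u v :
      cleq (ClMul t (ClAdd u v)) (ClAdd (ClMul t u) (ClMul t v))
  | cleq_scalD a b : cleq (ClScal (a + b)) (ClAdd (ClScal a) (ClScal b))
  | cleq_scalM a b : cleq (ClScal (a * b)) (ClMul (ClScal a) (ClScal b))
  | cleq_scalC a t : cleq (ClMul (ClScal a) t) (ClMul t (ClScal a))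
  | cleq_genD z w : cleq (ClGen (z + w)) (ClAdd (ClGen z) (ClGen w))
  | cleq_genZ a z : cleq (ClGen (a *: z)) (ClMul (ClScal a) (ClGen z))
  | cleq_clifford z : cleq (ClMul (ClGen z) (ClGen z)) (ClScal (- q z)).

Definition cleqb (t u : clterm) : bool := `[< cleq t u >].

Lemma cleqb_refl : reflexive cleqb.
Proof. by move=> t; apply/asboolP/cleq_refl. Qed.
Lemma cleqb_sym : symmetric cleqb.
Proof. by move=> t u; apply/asboolP/asboolP; apply: cleq_sym. Qed.
Lemma cleqb_trans : transitive cleqb.
Proof.
by move=> u t v /asboolP tu /asboolP uv; apply/asboolP/(cleq_trans tu).
Qed.

Canonical cleq_equiv := EquivRel cleqb cleqb_refl cleqb_sym cleqb_trans.

Definition clifford := {eq_quot cleq_equiv}.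
HB.instance Definition _ := Choice.on clifford.
HB.instance Definition _ := EqQuotient.on clifford.

Definition cl_class (t : clterm) : clifford := \pi_clifford t.

Lemma cl_classP t u : cl_class t = cl_class u <-> cleq t u.
Proof.
rewrite /cl_class; split=> [/eqP|tu]; first by rewrite eqmodE => /asboolP.
by apply/eqP; rewrite eqmodE; apply/asboolP.
Qed.

Lemma cl_repr (x : clifford) : cl_class (repr x) = x.
Proof. exact: reprK. Qed.

Lemma cl_ind (P : clifford -> Prop) :
  (forall t, P (cl_class t)) -> forall x, P x.
Proof. by move=> Pt x; rewrite -(cl_repr x). Qed.

Lemma repr_cl t : cleq (repr (cl_class t)) t.
Proof. by apply/cl_classP; rewrite cl_repr. Qed.

Definition cl_add (x y : clifford) := cl_class (ClAdd (repr x) (repr y)).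
Definition cl_mul (x y : clifford) := cl_class (ClMul (repr x) (repr y)).
Definition cl_opp (x : clifford) := cl_mul (cl_class (ClScal (-1))) x.
Definition cl_scale a (x : clifford) := cl_mul (cl_class (ClScal a)) x.

Lemma cl_addE t u : cl_add (cl_class t) (cl_class u) = cl_class (ClAdd t u).
Proof. by apply/cl_classP/cleq_add; apply: repr_cl. Qed.
Lemma cl_mulE t u : cl_mul (cl_class t) (cl_class u) = cl_class (ClMul t u).
Proof. by apply/cl_classP/cleq_mul; apply: repr_cl. Qed.

Fact cl_addA : associative cl_add.
Proof.
elim/cl_ind=> t; elim/cl_ind=> u; elim/cl_ind=> v.
by rewrite !cl_addE; apply/cl_classP/cleq_addA.
Qed.
Fact cl_addC : commutative cl_add.
Proof.
elim/cl_ind=> t; elim/cl_ind=> u.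
by rewrite !cl_addE; apply/cl_classP/cleq_addC.
Qed.
Fact cl_add0 : left_id (cl_class (ClScal 0)) cl_add.
Proof. by elim/cl_ind=> t; rewrite cl_addE; apply/cl_classP/cleq_add0. Qed.
Fact cl_addN : left_inverse (cl_class (ClScal 0)) cl_opp cl_add.
Proof.
by elim/cl_ind=> t; rewrite /cl_opp cl_mulE cl_addE; apply/cl_classP/cleq_addN.
Qed.
HB.instance Definition _ :=
  GRing.isZmodule.Build clifford cl_addA cl_addC cl_add0 cl_addN.

Fact cl_mulA : associative cl_mul.
Proof.
elim/cl_ind=> t; elim/cl_ind=> u; elim/cl_ind=> v.
by rewrite !cl_mulE; apply/cl_classP/cleq_mulA.
Qed.
Fact cl_mul1 : left_id (cl_class (ClScal 1)) cl_mul.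
Proof. by elim/cl_ind=> t; rewrite cl_mulE; apply/cl_classP/cleq_mul1. Qed.
Fact cl_scalC a x :
  cl_mul (cl_class (ClScal a)) x = cl_mul x (cl_class (ClScal a)).
Proof.
by elim/cl_ind: x => t; rewrite !cl_mulE; apply/cl_classP/cleq_scalC.
Qed.
Fact cl_mulr1 : right_id (cl_class (ClScal 1)) cl_mul.
Proof. by move=> x; rewrite -cl_scalC cl_mul1. Qed.
Fact cl_mulDl : left_distributive cl_mul +%R.
Proof.
elim/cl_ind=> t; elim/cl_ind=> u; elim/cl_ind=> v.
by rewrite /+%R /= !(cl_mulE, cl_addE); apply/cl_classP/cleq_mulDl.
Qed.
Fact cl_mulDr : right_distributive cl_mul +%R.
Proof.
elim/cl_ind=> t; elim/cl_ind=> u; elim/cl_ind=> v.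
by rewrite /+%R /= !(cl_mulE, cl_addE); apply/cl_classP/cleq_mulDr.
Qed.
HB.instance Definition _ := GRing.Zmodule_isPzRing.Build clifford
  cl_mulA cl_mul1 cl_mulr1 cl_mulDl cl_mulDr.

Fact cl_scaleA a b x : cl_scale a (cl_scale b x) = cl_scale (a * b) x.
Proof.
rewrite /cl_scale cl_mulA cl_mulE; congr cl_mul.
exact/cl_classP/cleq_sym/cleq_scalM.
Qed.
Fact cl_scale1 : left_id 1 cl_scale.
Proof. exact: cl_mul1. Qed.
Fact cl_scaleDr : right_distributive cl_scale +%R.
Proof. by move=> a x y; apply: cl_mulDr. Qed.
Fact cl_scaleDl x : {morph cl_scale^~ x : a b / a + b}.
Proof.
move=> a b; rewrite /cl_scale -cl_mulDl; congr cl_mul.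
by rewrite /+%R /= cl_addE; apply/cl_classP/cleq_scalD.
Qed.
HB.instance Definition _ := GRing.Zmodule_isLmodule.Build R clifford
  cl_scaleA cl_scale1 cl_scaleDr cl_scaleDl.

Fact cl_scaleAl a (x y : clifford) : a *: (x * y) = (a *: x) * y.
Proof. exact: cl_mulA. Qed.
Fact cl_scaleAr a (x y : clifford) : a *: (x * y) = x * (a *: y).
Proof.
rewrite -[LHS]/(cl_mul _ (cl_mul x y)) -[RHS]/(cl_mul x (cl_mul _ y)).
by rewrite !cl_mulA cl_scalC.
Qed.

Definition cl_gen (z : W) : clifford := cl_class (ClGen z).

Fact cl_gen_linear : linear cl_gen.
Proof.
move=> a z w; rewrite -[RHS]/(cl_add (cl_mul _ _) _) cl_mulE cl_addE.
apply/cl_classP/(cleq_trans (cleq_genD _ _))/cleq_add; last exact: cleq_refl.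
exact: cleq_genZ.
Qed.
HB.instance Definition _ :=
  GRing.isLinear.Build R W clifford _ cl_gen cl_gen_linear.

Lemma cl_gen_sqr z : cl_gen z * cl_gen z = (- q z) *: (1 : clifford).
Proof.
rewrite -[LHS]/(cl_mul _ _) -[RHS]/(cl_mul _ (cl_class (ClScal 1))) !cl_mulE.
apply/cl_classP/(cleq_trans (cleq_clifford _))/cleq_sym.
by apply: cleq_trans (cleq_scalC _ _) (cleq_mul1 _).
Qed.

End Clifford.

Section CliffordModules.
Variables (R : fieldType) (W : lmodType R) (q : W -> R).

(* In MathComp 'End(V) is a ring only for V <> 0, hence explicit conditions. *)
Definition clifford_module (V : vectType R)
    (rho : {linear clifford q -> 'End(V)}) : Prop :=
  rho 1 = \1%VF /\ forall a b, rho (a * b) = (rho a \o rho b)%VF.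

Definition admissible (V : vectType R)
    (rho : {linear clifford q -> 'End(V)}) : Prop :=
  clifford_module rho /\
  exists b : {symmetric V}, nondegenerate b /\
    forall z x y, b (rho (cl_gen q z) x) y = - b x (rho (cl_gen q z) y).

(* The zero module is vacuously admissible, so minimality is among the nonzero
   admissible modules. *)
Definition minimal_admissible (V : vectType R)
    (rho : {linear clifford q -> 'End(V)}) : Prop :=
  [/\ admissible rho, (0 < \dim {:V})%N
    & forall (V' : vectType R) (rho' : {linear clifford q -> 'End(V')}),
        admissible rho' -> (0 < \dim {:V'})%N -> (\dim {:V} <= \dim {:V'})%N].

Section Lift.
Variables (V : vectType R) (J : {linear W -> 'End(V)}).
Hypothesis J_sqr : forall z, (J z \o J z)%VF = (- q z) *: \1%VF.

Fixpoint cl_eval (t : clterm W) : 'End(V) :=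
  match t with
  | ClGen z => J z
  | ClScal a => a *: \1%VF
  | ClAdd t u => cl_eval t + cl_eval u
  | ClMul t u => (cl_eval t \o cl_eval u)%VF
  end.

Lemma cl_eval_cleq t u : cleq q t u -> cl_eval t = cl_eval u.
Proof.
elim=> //= {t u}.
- by move=> t u v _ -> _ ->.
- by move=> t t' u u' _ -> _ ->.
- by move=> t t' u u' _ -> _ ->.
- by move=> t u v; rewrite addrA.
- by move=> t u; rewrite addrC.
- by move=> t; rewrite scale0r add0r.
- by move=> t; rewrite -comp_lfunZl comp_lfun1l scaleN1r addNr scale0r.
- by move=> t u v; rewrite comp_lfunA.
- by move=> t; rewrite scale1r comp_lfun1l.
- by move=> t u v; rewrite comp_lfunDl.
- by move=> t u v; rewrite comp_lfunDr.
- by move=> a b; rewrite scalerDl.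
- by move=> a b; rewrite -comp_lfunZl comp_lfun1l scalerA.
- by move=> a t; rewrite -comp_lfunZl -comp_lfunZr comp_lfun1l comp_lfun1r.
- by move=> z w; rewrite linearD.
- by move=> a z; rewrite linearZ -comp_lfunZl comp_lfun1l.
Qed.

Definition cl_lift (x : clifford q) : 'End(V) := cl_eval (repr x).

Lemma cl_lift_class t : cl_lift (cl_class q t) = cl_eval t.
Proof. exact/cl_eval_cleq/repr_cl. Qed.

Fact cl_lift_linear : linear cl_lift.
Proof.
move=> a x y; rewrite -{1}(cl_repr x) -{1}(cl_repr y).
rewrite -[_ + _]/(cl_add (cl_mul _ _) _) cl_mulE cl_addE cl_lift_class /=.
by rewrite -comp_lfunZl comp_lfun1l.
Qed.
HB.instance Definition _ :=
  GRing.isLinear.Build R (clifford q) 'End(V) _ cl_lift cl_lift_linear.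

Lemma cl_lift_module : clifford_module cl_lift.
Proof.
split=> [|x y]; first by rewrite [LHS]cl_lift_class /= scale1r.
rewrite -{1}(cl_repr x) -{1}(cl_repr y).
by rewrite -[_ * _]/(cl_mul _ _) cl_mulE [LHS]cl_lift_class.
Qed.

Lemma cl_lift_gen z : cl_lift (cl_gen q z) = J z.
Proof. exact: cl_lift_class. Qed.

End Lift.

Lemma clifford_module_gen_sqr (V : vectType R)
    (rho : {linear clifford q -> 'End(V)}) z : clifford_module rho ->
  (rho (cl_gen q z) \o rho (cl_gen q z))%VF = (- q z) *: \1%VF.
Proof. by case=> rho1 rhoM; rewrite -rhoM cl_gen_sqr linearZ /= rho1. Qed.

End CliffordModules.

Section Signature.
Variable R : realFieldType.

(* The Gram matrix of b in some basis of U has r positive and s negative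
   eigenvalues, counted with multiplicity; by Sylvester's law of inertia the
   choice of the basis is immaterial. *)
Definition has_signature (V : vectType R) (U : {vspace V}) (b : V -> V -> R)
    (r s : nat) : Prop :=
  exists n (e : n.-tuple V) (ev : seq R),
    [/\ basis_of U e,
        char_poly (\matrix_(i < n, j < n) b (tnth e i) (tnth e j)) =
          \prod_(a <- ev) ('X - a%:P),
        count (> 0) ev = r
      & count (< 0) ev = s].

End Signature.

Section LieAlgebras.
Variable R : fieldType.

Record lieAlg := LieAlg {
  lie_sort :> vectType R;
  lie_br : {bilinear lie_sort -> lie_sort -> lie_sort};
  lie_alt : forall x, lie_br x x = 0;
  lie_jacobi : forall x y z,
    lie_br x (lie_br y z) + lie_br y (lie_br z x) + lie_br z (lie_br x y) = 0
}.

(* n = gr2 (+) gr1, where gr2 is n_{-2} and gr1 is n_{-1}. *)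
Record gradedLie2 := GradedLie2 {
  gr_lie :> lieAlg;
  gr2 : {vspace gr_lie};
  gr1 : {vspace gr_lie};
  gr_sum : (gr2 + gr1 = fullv)%VS;
  gr_cap : (gr2 :&: gr1 = 0)%VS;
  gr_br : {in gr1 &, forall x y, lie_br gr_lie x y \in gr2};
  gr_central : forall z x, z \in gr2 -> lie_br gr_lie z x = 0;
  gr_nonabelian : exists x y, lie_br gr_lie x y != 0
}.

Definition graded_iso (A B : gradedLie2) : Prop :=
  exists f : 'Hom(A, B),
    [/\ bijective f, forall x y, f (lie_br A x y) = lie_br B (f x) (f y),
        (f @: gr2 A)%VS = gr2 B & (f @: gr1 A)%VS = gr1 B].

Record pseudoH := PseudoH {
  ph_lie :> gradedLie2;
  ph_form : {symmetric ph_lie};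
  ph_nondeg : nondegenerate ph_form;
  ph_orth : forall z x, z \in gr2 ph_lie -> x \in gr1 ph_lie -> ph_form z x = 0;
  ph_nondeg2 : forall z, z \in gr2 ph_lie ->
    (forall w, w \in gr2 ph_lie -> ph_form z w = 0) -> z = 0;
  ph_J : subvs_of (gr2 ph_lie) -> 'End(subvs_of (gr1 ph_lie));
  ph_J_def : forall (z : subvs_of (gr2 ph_lie)) (x y : subvs_of (gr1 ph_lie)),
    ph_form (vsval (ph_J z x)) (vsval y) =
    ph_form (lie_br ph_lie (vsval x) (vsval y)) (vsval z);
  ph_J_sqr : forall z : subvs_of (gr2 ph_lie),
    (ph_J z \o ph_J z)%VF = (- ph_form (vsval z) (vsval z)) *: \1%VF
}.

End LieAlgebras.

Arguments lie_br {R l}.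

(* N is a pseudo H-type algebra n^{r,s}; rho is the extension of J to the
   Clifford algebra of n_{-2}. *)
Definition is_n_rs (R : realFieldType) (N : pseudoH R) (r s : nat) : Prop :=
  has_signature (gr2 N) (ph_form N) r s /\
  exists rho : {linear
      clifford (fun z : subvs_of (gr2 N) => ph_form N (vsval z) (vsval z)) ->
      'End(subvs_of (gr1 N))},
    (forall z, rho (cl_gen _ z) = ph_J z) /\ minimal_admissible rho.

(* Two subspaces n2, n1 of a Lie algebra L with n2 :&: n1 = 0, [n1, n1] <= n2,
   [n2, n2 + n1] = 0 and [n1, n1] <> 0, as a graded Lie algebra n2 (+) n1. *)
Section SubGraded.
Variables (R : fieldType) (L : lieAlg R) (n2 n1 : {vspace L}).
Hypothesis n21_cap : (n2 :&: n1 = 0)%VS.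
Hypothesis n1_br : {in n1 &, forall x y, lie_br x y \in n2}.
Hypothesis n2_central : {in n2 & (n2 + n1)%VS, forall z x, lie_br z x = 0}.
Hypothesis n1_nonabelian :
  exists x y, [/\ x \in n1, y \in n1 & lie_br x y != 0].

Local Notation U := (n2 + n1)%VS.

Lemma lie_anti (x y : L) : lie_br y x = - lie_br x y.
Proof.
apply/eqP; rewrite -addr_eq0; have := lie_alt (x + y).
by rewrite linearDl !linearDr !lie_alt addr0 add0r addrC => ->.
Qed.

Lemma sum_br : {in U &, forall x y, lie_br x y \in U}.
Proof.
move=> _ y /memv_addP[z zn [x xn ->]] yU.
rewrite linearDl n2_central // add0r.
case/memv_addP: yU => z' z'n [x' x'n ->].
rewrite linearDr lie_anti n2_central ?oppr0 ?add0r //.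
  by rewrite (subvP (addvSl _ _)) ?n1_br.
by rewrite (subvP (addvSr _ _)).
Qed.

Definition sub_br (x y : subvs_of U) : subvs_of U :=
  vsproj U (lie_br (vsval x) (vsval y)).

Fact sub_br_bilinear :
  bilinear_for (GRing.Scale.Law.clone _ _ *:%R _)
               (GRing.Scale.Law.clone _ _ *:%R _) sub_br.
Proof.
by split=> [y|x] a u v; rewrite /sub_br linearP ?linearPl ?linearPr linearP.
Qed.
HB.instance Definition _ := bilinear_isBilinear.Build R
  (subvs_of U) (subvs_of U) (subvs_of U) _ _ sub_br sub_br_bilinear.

Lemma sub_brE x y : vsval (sub_br x y) = lie_br (vsval x) (vsval y).
Proof. by rewrite vsprojK ?sum_br ?subvsP. Qed.

Fact sub_alt x : sub_br x x = 0.
Proof. by apply/subvs_inj; rewrite sub_brE lie_alt. Qed.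

Fact sub_jacobi x y z :
  sub_br x (sub_br y z) + sub_br y (sub_br z x) + sub_br z (sub_br x y) = 0.
Proof. by apply/subvs_inj; rewrite !linearD /= !sub_brE lie_jacobi. Qed.

Definition sub_lie : lieAlg R :=
  @LieAlg R (subvs_of U) sub_br sub_alt sub_jacobi.

(* The subspace V :&: U of L, as a subspace of U. *)
Definition subv_in (V : {vspace L}) : {vspace sub_lie} :=
  (linfun (vsval : subvs_of U -> L) @^-1: V)%VS.

Lemma mem_subv_in V (x : sub_lie) : (x \in subv_in V) = (vsval x \in V).
Proof. by rewrite -memv_preim lfunE. Qed.

Fact sub_sum : (subv_in n2 + subv_in n1 = fullv)%VS.
Proof.
apply/eqP; rewrite eqEsubv subvf; apply/subvP=> x _.
have /memv_addP[z zn [y yn xE]] := subvsP x.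
have zU : z \in U by rewrite (subvP (addvSl _ _)).
have yU : y \in U by rewrite (subvP (addvSr _ _)).
apply/memv_addP; exists (Subvs zU); first by rewrite mem_subv_in.
by exists (Subvs yU); [rewrite mem_subv_in | apply/subvs_inj].
Qed.

Fact sub_cap : (subv_in n2 :&: subv_in n1 = 0)%VS.
Proof.
apply/eqP; rewrite -subv0; apply/subvP=> x.
rewrite memv_cap !mem_subv_in -memv_cap n21_cap !memv0 => /eqP x0.
by apply/eqP/subvs_inj.
Qed.

Fact sub_gr_br :
  {in subv_in n1 &, forall x y, lie_br (l := sub_lie) x y \in subv_in n2}.
Proof. by move=> x y; rewrite !mem_subv_in sub_brE; apply: n1_br. Qed.

Fact sub_central (z x : sub_lie) : z \in subv_in n2 -> lie_br z x = 0.
Proof.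
rewrite mem_subv_in => zn; apply/subvs_inj.
by rewrite sub_brE n2_central ?subvsP.
Qed.

Fact sub_nonabelian : exists x y : sub_lie, lie_br x y != 0.
Proof.
have [x [y [xn yn xy0]]] := n1_nonabelian.
have xU : x \in U by rewrite (subvP (addvSr _ _)).
have yU : y \in U by rewrite (subvP (addvSr _ _)).
exists (Subvs xU), (Subvs yU); apply: contra_neq xy0 => /congr_subvs.
by rewrite sub_brE.
Qed.

Definition sub_graded : gradedLie2 R :=
  GradedLie2 sub_sum sub_cap sub_gr_br sub_central sub_nonabelian.

End SubGraded.

Local Open Scope complex_scope.
Local Open Scope sesquilinear_scope.

(* Complex n x n matrices, as a vector space over the reals. *)
Definition realmx (R : rcfType) (n : nat) : Type := 'M[R[i]]_n.

Section RealMatrices.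
Variables (R : rcfType) (n : nat).
Local Notation M := (realmx R n).

HB.instance Definition _ := GRing.Zmodule.on M.

Definition realmx_scale (a : R) (X : M) : M := a%:C *: (X : 'M[R[i]]_n).

Fact realmx_scaleA a b X :
  realmx_scale a (realmx_scale b X) = realmx_scale (a * b) X.
Proof. by rewrite /realmx_scale scalerA rmorphM. Qed.
Fact realmx_scale1 : left_id 1 realmx_scale.
Proof. by move=> X; rewrite /realmx_scale rmorph1 scale1r. Qed.
Fact realmx_scaleDr : right_distributive realmx_scale +%R.
Proof. by move=> a X Y; apply: scalerDr. Qed.
Fact realmx_scaleDl X : {morph realmx_scale^~ X : a b / a + b}.
Proof. by move=> a b; rewrite /realmx_scale rmorphD scalerDl. Qed.
HB.instance Definition _ := GRing.Zmodule_isLmodule.Build R M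
  realmx_scaleA realmx_scale1 realmx_scaleDr realmx_scaleDl.

Lemma realmx_scaleE (a : R) (X : M) : a *: X = a%:C *: (X : 'M[R[i]]_n).
Proof. by []. Qed.

Fact realmx_vect_iso : Vector.axiom (n * n + n * n) M.
Proof.
pose v (X : M) : 'rV[R]_(n * n + n * n) :=
  row_mx (mxvec (\matrix_(i, j) complex.Re (X i j)))
         (mxvec (\matrix_(i, j) complex.Im (X i j))).
exists v.
  move=> a X Y; rewrite /v scale_row_mx add_row_mx -!linearP.
  by congr (row_mx (mxvec _) (mxvec _)); apply/matrixP=> i j;
    rewrite realmx_scaleE !mxE; case: (X i j) (Y i j) => [x x'] [y y'] /=;
    rewrite mul0r ?subr0 ?addr0.
exists (fun r => \matrix_(i, j)
  ((vec_mx (lsubmx r) i j) +i* (vec_mx (rsubmx r) i j))%C).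
  move=> X; apply/matrixP=> i j; rewrite mxE row_mxKl row_mxKr !mxvecK !mxE.
  by case: (X i j).
move=> r; rewrite -[RHS]hsubmxK /v; congr row_mx; apply/(can_inj vec_mxK);
  by rewrite mxvecK; apply/matrixP=> i j; rewrite !mxE.
Qed.
HB.instance Definition _ := Lmodule_hasFinDim.Build R M realmx_vect_iso.

Definition comm_br (X Y : M) : M := X *m Y - Y *m X.

Fact comm_br_bilinear :
  bilinear_for (GRing.Scale.Law.clone _ _ *:%R _)
               (GRing.Scale.Law.clone _ _ *:%R _) comm_br.
Proof.
split=> [Y|X] a U V; rewrite /comm_br /= !realmx_scaleE.
  by rewrite mulmxDl mulmxDr -scalemxAl -scalemxAr scalerBr opprD addrACA.
by rewrite mulmxDl mulmxDr -scalemxAl -scalemxAr scalerBr opprD addrACA.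
Qed.
HB.instance Definition _ := bilinear_isBilinear.Build R M M M _ _
  comm_br comm_br_bilinear.

Fact comm_alt X : comm_br X X = 0.
Proof. exact: subrr. Qed.

Fact comm_jacobi X Y Z :
  comm_br X (comm_br Y Z) + comm_br Y (comm_br Z X) + comm_br Z (comm_br X Y)
  = 0.
Proof.
rewrite /comm_br !(mulmxBl, mulmxBr) !mulmxA.
by apply/matrixP=> i j; rewrite !mxE; ring.
Qed.

(* gl(n, C) as a real Lie algebra. *)
Definition gl : lieAlg R := @LieAlg R M comm_br comm_alt comm_jacobi.

End RealMatrices.

Section SU33.
Variable R : rcfType.
Local Notation C := R[i].
Local Notation gl6 := (gl R 6).

(* Indices run over 0..5, so the condition k + l = 7 becomes k + l = 5. *)
Definition sigma : 'M[C]_6 := \matrix_(k, l) (k + l == 5)%N%:R.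

Definition su_fun (X : gl6) : gl6 := X + sigma *m (X : 'M[C]_6)^t* *m sigma.

Fact su_fun_linear : linear su_fun.
Proof.
move=> a X Y; rewrite /su_fun !realmx_scaleE.
have ->: (a%:C *: (X : 'M[C]_6) + (Y : 'M[C]_6))^t* =
    a%:C *: (X : 'M[C]_6)^t* + (Y : 'M[C]_6)^t*.
  apply/matrixP=> i j; rewrite !mxE rmorphD rmorphM /=.
  by rewrite conj_Creal ?complex_real.
by rewrite mulmxDr mulmxDl -scalemxAr -scalemxAl scalerDr addrACA.
Qed.
HB.instance Definition _ :=
  GRing.isLinear.Build R gl6 gl6 _ su_fun su_fun_linear.

Definition tr_fun (X : gl6) : gl6 := (\tr (X : 'M[C]_6))%:M.

Fact tr_fun_linear : linear tr_fun.
Proof.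
move=> a X Y; rewrite /tr_fun !realmx_scaleE linearD linearZ /=.
by rewrite raddfD /= scale_scalar_mx.
Qed.
HB.instance Definition _ :=
  GRing.isLinear.Build R gl6 gl6 _ tr_fun tr_fun_linear.

Definition su33 : {vspace gl6} :=
  (lker (linfun tr_fun) :&: lker (linfun su_fun))%VS.

Lemma mem_su33 (X : gl6) : (X \in su33) =
  (\tr (X : 'M[C]_6) == 0) && (X + sigma *m (X : 'M[C]_6)^t* *m sigma == 0).
Proof.
rewrite memv_cap !memv_ker !lfunE /=; congr (_ && _).
apply/eqP/eqP=> [/matrixP/(_ 0 0)|X0]; first by rewrite !mxE eqxx.
by apply/matrixP=> i j; rewrite /tr_fun X0 !mxE mul0rn.
Qed.

Definition cE (c : C) (k l : 'I_6) : gl6 := c *: (delta_mx k l : 'M[C]_6).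

(* [k./2] is the index of the block containing k, for the partition
   {0, 1}, {2, 3}, {4, 5}; [gneg d] is g_{-d}, the complex span of the E_{kl}
   with k exactly d blocks below l, here as the real span of the E_{kl} and
   the 'i E_{kl}. *)
Definition gneg (d : nat) : {vspace gl6} :=
  (\sum_(k < 6) \sum_(l < 6 | k./2 == (l./2 + d)%N)
     (<[cE 1 k l]> + <[cE 'i k l]>))%VS.

(* n_{-d}; the graded Lie algebra n_{-2} (+) n_{-1} is [su33_neg] below. *)
Definition nneg (d : nat) : {vspace gl6} := (gneg d :&: su33)%VS.

Lemma mem_gneg d (X : gl6) : reflect
  (forall k l : 'I_6, k./2 != (l./2 + d)%N -> X k l = 0) (X \in gneg d).
Proof.
apply: (iffP idP) => [/memv_sumP[f fP ->] k l kl|X0].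
  rewrite summxE big1 // => i _; have /memv_sumP[g gP ->] := fP i isT.
  rewrite summxE big1 // => j ij; have /memv_addP[u uP [v vP ->]] := gP j ij.
  have {uP}/vlineP[a ->] := uP; have {vP}/vlineP[b ->] := vP.
  rewrite !realmx_scaleE !mxE.
  suff -> : (k == i) && (l == j) = false by rewrite !mulr0 addr0.
  by apply: contraNF kl => /andP[/eqP-> /eqP->].
have -> : X = \sum_(k < 6) \sum_(l < 6) cE (X k l) k l :> gl6.
  exact: matrix_sum_delta.
apply: memv_sumr => k _.
rewrite (bigID (fun l : 'I_6 => k./2 == (l./2 + d)%N)) /= [X in _ + X]big1.
  rewrite addr0; apply: memv_sumr => l kl.
  case: (X k l) => a b.
  have -> : cE (a +i* b) k l = a *: cE 1 k l + b *: cE 'i k l.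
    apply/matrixP=> i j; rewrite !realmx_scaleE !mxE; case: (_ && _) => /=.
      rewrite !mulr1; apply/eqP; rewrite eq_complex /=.
      by rewrite !(mulr0, mulr1, mul0r, addr0, add0r, subr0) !eqxx.
    by rewrite !mulr0 addr0.
  by apply: memv_add; apply: memvZ; apply: memv_line.
by move=> l kl; rewrite X0 // /cE scale0r.
Qed.

Lemma sigma_conj (A : 'M[C]_6) k l :
  (sigma *m A *m sigma) k l = A (rev_ord k) (rev_ord l).
Proof.
have sig (i j : 'I_6) : (i + j == 5)%N = (j == rev_ord i).
  by rewrite -val_eqE /=; case: i j => [i +] [j +] /=; lia.
rewrite !mxE (bigD1 (rev_ord l)) //= big1 => [|j jl].
  rewrite !mxE sig rev_ordK eqxx mulr1 addr0 (bigD1 (rev_ord k)) //= big1.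
    by rewrite !mxE sig eqxx mul1r addr0.
  by move=> i ik; rewrite !mxE sig (negPf ik) mul0r.
by rewrite !mxE addnC sig (negPf jl) mulr0.
Qed.

Lemma mem_nneg d X : (X \in nneg d) = (X \in gneg d) && (X \in su33).
Proof. exact: memv_cap. Qed.

Lemma nnegP d (X : gl6) : (0 < d)%N -> reflect
  ((forall k l : 'I_6, k./2 != (l./2 + d)%N -> X k l = 0) /\
   (forall k l, X k l + (X (rev_ord l) (rev_ord k))^*%C = 0))
  (X \in nneg d).
Proof.
move=> d0; rewrite memv_cap mem_su33.
apply: (iffP and3P) => [[/mem_gneg X0 _ /eqP suX]|[X0 suX]].
  split=> // k l; move/matrixP/(_ k l): suX.
  by rewrite [LHS]mxE sigma_conj !mxE.
split; first exact/mem_gneg.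
  rewrite /mxtrace big1 // => k _; apply: X0.
  by rewrite -[X in X != _]addn0 eqn_add2l eq_sym -lt0n.
by apply/eqP/matrixP=> k l; rewrite [LHS]mxE sigma_conj !mxE -[RHS](suX k l).
Qed.

Fact nneg_cap : (nneg 2 :&: nneg 1 = 0)%VS.
Proof.
apply/eqP; rewrite -subv0; apply/subvP=> X; rewrite memv_cap memv0.
case/andP=> /nnegP-/(_ isT)[X2 _] /nnegP-/(_ isT)[X1 _].
apply/eqP/matrixP=> k l; rewrite mxE.
by have [kl|/X2//] := eqVneq k./2 (l./2 + 2)%N; apply: X1; rewrite kl eqn_add2l.
Qed.

Lemma su33_br : {in su33 &, forall X Y, comm_br X Y \in su33}.
Proof.
have sK A B : sigma *m A *m sigma *m (sigma *m B *m sigma) =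
    sigma *m (A *m B) *m sigma :> 'M[C]_6.
  suff ss : sigma *m sigma = 1%:M :> 'M[C]_6.
    by rewrite !mulmxA -(mulmxA _ sigma sigma) ss mulmx1.
  apply/matrixP=> k l; rewrite -[sigma in X in X *m _]mulmx1 sigma_conj !mxE.
  by rewrite (inj_eq rev_ord_inj).
move=> X Y; rewrite !mem_su33 => /andP[_ /eqP suX] /andP[_ /eqP suY].
have adjM (A B : 'M[C]_6) : (A *m B)^t* = B^t* *m A^t*.
  by rewrite trmx_mul map_mxM.
have adjB (A B : 'M[C]_6) : (A - B)^t* = A^t* - B^t*.
  by apply/matrixP=> i j; rewrite !mxE rmorphB.
have {}suX : sigma *m (X : 'M[C]_6)^t* *m sigma = - X.
  by apply/eqP; rewrite -addr_eq0 addrC suX.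
have {}suY : sigma *m (Y : 'M[C]_6)^t* *m sigma = - Y.
  by apply/eqP; rewrite -addr_eq0 addrC suY.
have tr0 : \tr ((X : 'M[C]_6) *m Y - Y *m X) = 0.
  by rewrite raddfB /= mxtrace_mulC; apply: subrr.
rewrite /comm_br tr0 eqxx /=.
rewrite adjB !adjM mulmxBr mulmxBl -!sK suX suY !mulNmx !mulmxN !opprK.
by rewrite addrA subrK subrr.
Qed.

Fact nneg_br : {in nneg 1 &, forall X Y : gl6, lie_br X Y \in nneg 2}.
Proof.
move=> X Y /[!mem_nneg] /andP[/mem_gneg X0 Xsu] /andP[/mem_gneg Y0 Ysu].
apply/andP; split; last exact: su33_br.
apply/mem_gneg=> k l kl.
have mul0 (A B : gl6) :
    (forall k l : 'I_6, k./2 != (l./2 + 1)%N -> A k l = 0) ->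
    (forall k l : 'I_6, k./2 != (l./2 + 1)%N -> B k l = 0) ->
    (A *m B) k l = 0.
  move=> A0 B0; rewrite mxE big1 // => m _.
  have [km|/A0->] := eqVneq k./2 (m./2 + 1)%N; last by rewrite mul0r.
  rewrite B0 ?mulr0 //; apply: contraNneq kl => ml.
  by rewrite km ml -addnA.
by rewrite [LHS]mxE [X in _ + X]mxE !mul0 ?subr0.
Qed.

Fact nneg_central :
  {in nneg 2 & (nneg 2 + nneg 1)%VS, forall Z X : gl6, lie_br Z X = 0}.
Proof.
move=> Z X /[!mem_nneg] /andP[/mem_gneg Z0 _].
case/memv_addP=> U /[!mem_nneg] /andP[/mem_gneg U0 _].
case=> V /[!mem_nneg] /andP[/mem_gneg V0 _] ->.
have X0 (k l : 'I_6) : (k./2 <= l./2)%N -> (U + V) k l = 0.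
  by move=> kl; rewrite mxE U0 ?V0 ?addr0 //; lia.
apply/matrixP=> k l; rewrite [LHS]mxE [X in _ + X]mxE !mxE.
rewrite !big1 ?subr0 // => m _.
  have [ml|/Z0->] := eqVneq m./2 (l./2 + 2)%N; last by rewrite mulr0.
  by rewrite X0 ?mul0r //; have := ltn_ord k; lia.
have [km|/Z0->] := eqVneq k./2 (m./2 + 2)%N; last by rewrite mul0r.
by rewrite X0 ?mulr0 //; have := ltn_ord k; lia.
Qed.

Fact nneg_nonabelian :
  exists X Y : gl6, [/\ X \in nneg 1, Y \in nneg 1 & lie_br X Y != 0].
Proof.
pose X : gl6 := \matrix_(k, l)
  if (val k, val l) == (2, 0)%N then 1 else
  if (val k, val l) == (5, 3)%N then -1 else 0.
pose Y : gl6 := \matrix_(k, l)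
  if (val k, val l) \in [:: (3, 0)%N; (5, 2)%N] then 'i else 0.
exists X, Y; split.
- apply/nnegP => //; split=> k l; rewrite !mxE.
    by case: k l => [[|[|[|[|[|[|k]]]]]] hk] [[|[|[|[|[|[|l]]]]]] hl].
  by case: k l => [[|[|[|[|[|[|k]]]]]] hk] [[|[|[|[|[|[|l]]]]]] hl] //=;
    apply/eqP; rewrite eq_complex /= ?oppr0 ?addr0 ?subrr ?addNr ?eqxx.
- apply/nnegP => //; split=> k l; rewrite !mxE.
    by case: k l => [[|[|[|[|[|[|k]]]]]] hk] [[|[|[|[|[|[|l]]]]]] hl].
  by case: k l => [[|[|[|[|[|[|k]]]]]] hk] [[|[|[|[|[|[|l]]]]]] hl] //=;
    apply/eqP; rewrite eq_complex /= ?oppr0 ?addr0 ?subrr ?addNr ?eqxx.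
apply/eqP=> /matrixP/(_ (inord 5) (inord 0)).
rewrite [LHS]mxE [X in _ + X]mxE !mxE !big_ord_recr !big_ord0 /= !mxE /=.
rewrite !inordK //= => /eqP; rewrite eq_complex /=.
rewrite !(mulr0, mul0r, mulr1, mul1r, addr0, add0r, subr0, oppr0) /=.
by rewrite eqxx -opprD oppr_eq0 (pnatr_eq0 R 2).
Qed.

Definition su33_neg : gradedLie2 R :=
  sub_graded nneg_cap nneg_br nneg_central nneg_nonabelian.

End SU33.

(* Main.v *)
Require Import Defs.
From HB Require Import structures.
From mathcomp Require Import all_boot all_order all_algebra reals.
From mathcomp Require Import sesquilinear zify ring.
From mathcomp.real_closed Require Import complex.

(* An element of n_{-1} is determined by its block A = (rows 3, 4; columns 1, 2)
   and an element of n_{-2} by its block C = (rows 5, 6; columns 1, 2), which is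
   subject to C = - s C^* s with s antidiagonal. On n_{-2} the determinant of C
   is a real quadratic form of signature (1,3); on n_{-1} take the quadratic
   form 2 Re (det A). Then J_Z sends A to tau conj(A [c22, c12; - c21, - c11]) with
   tau = diag(1, -1), and J_Z squares to - det C. So n_{-1} is an admissible
   module of dimension 8.

   No nonzero admissible module is smaller: if z1, .., z4 are orthonormal
   generators with z1^2 = -1 and z2^2 = z3^2 = z4^2 = 1, then z2 and z1 z3 are
   commuting involutions, and the four joint eigenspaces are permuted by z1 and
   z4, hence have equal dimension. On the joint (1,1)-eigenspace the form
   b(z1 x, y) is alternating and nondegenerate, so that this dimension is at
   least 2. *)

Set Implicit Arguments.
Unset Strict Implicit.
Unset Printing Implicit Defensive.

Import Order.TTheory GRing.Theory Num.Theory.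
Local Open Scope ring_scope.
Local Open Scope complex_scope.

(** * Lower bound on the dimension of a module over four anticommuting generators *)

Section CliffordDimension.
Variables (R : realFieldType) (V : vectType R).

(** [T] embeds [U] into a subspace of [W] independent of [U], so [W] has room for two copies of
    [U]. *)
Lemma double_dim_leq (U U' W : {vspace V}) (T : 'End(V)) : injective T ->
    (U <= W)%VS -> (U' <= W)%VS -> (U :&: U' = 0)%VS -> (T @: U <= U')%VS ->
  (2 * \dim U <= \dim W)%N.
Proof.
move=> Tinj UW U'W UU' TU.
have : (\dim (U + U') <= \dim W)%N by apply: dimvS; rewrite subv_add UW.
rewrite dimv_disjoint_sum //; have := dimvS TU.
rewrite limg_dim_eq; first by lia.
by have /lker0P/eqP-> := Tinj; rewrite capv0.
Qed.

Lemma fixedSpace_capN (P : 'End(V)) (U : {vspace V}) :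
  (fixedSpace P :&: U :&: (fixedSpace (- P) :&: U) = 0)%VS.
Proof.
apply/eqP; rewrite -subv0; apply/subvP=> v; rewrite memv0 !memv_cap.
move=> /andP[/andP[/fixedSpaceP Pv _] /andP[/fixedSpaceP + _]].
rewrite opp_lfunE Pv => /eqP; rewrite eq_sym -addr_eq0 -mulr2n -scaler_nat.
by rewrite scaler_eq0 pnatr_eq0.
Qed.

Variables (b : {symmetric V}) (e1 e2 e3 e4 : 'End(V)).
Hypotheses (b_nondeg : nondegenerate b) (V_gt0 : (0 < \dim {:V})%N).
Hypotheses (e1_skew : forall x y, b (e1 x) y = - b x (e1 y))
  (e2_skew : forall x y, b (e2 x) y = - b x (e2 y))
  (e3_skew : forall x y, b (e3 x) y = - b x (e3 y)).
Hypotheses (e11 : forall x, e1 (e1 x) = - x) (e22 : forall x, e2 (e2 x) = x)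
  (e33 : forall x, e3 (e3 x) = x) (e44 : forall x, e4 (e4 x) = x).
Hypotheses (e21 : forall x, e2 (e1 x) = - e1 (e2 x))
  (e31 : forall x, e3 (e1 x) = - e1 (e3 x))
  (e41 : forall x, e4 (e1 x) = - e1 (e4 x))
  (e32 : forall x, e3 (e2 x) = - e2 (e3 x))
  (e42 : forall x, e4 (e2 x) = - e2 (e4 x))
  (e43 : forall x, e4 (e3 x) = - e3 (e4 x)).

Let U := (fixedSpace (e1 \o e3)%VF :&: fixedSpace e2)%VS.

Let memU x : (x \in U) = (e1 (e3 x) == x) && (e2 x == x).
Proof.
by rewrite memv_cap; congr (_ && _); apply/fixedSpaceP/eqP; rewrite ?lfunE.
Qed.

Let T13 x : e1 (e3 (e1 (e3 x))) = x.
Proof. by rewrite e31 linearN /= e33 e11 opprK. Qed.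

Let C13 x : e2 (e1 (e3 x)) = e1 (e3 (e2 x)).
Proof. by rewrite e21 e32 linearN. Qed.

(** Four times the projection onto [U]: the product of 1 + e1 e3 and 1 + e2, left unnormalised. *)
Let proj x := let y := x + e2 x in y + e1 (e3 y).

Let projU x : proj x \in U.
Proof.
have : e2 (x + e2 x) = x + e2 x by rewrite linearD /= e22 addrC.
rewrite memU /proj; move: (x + e2 x) => y e2y.
by rewrite !linearD /= T13 C13 e2y addrC !eqxx.
Qed.

(** Skewness moves e2 and e1 e3 to the first argument, where they fix [e1 x] up to signs that
    cancel. So the four terms of [proj y] pair alike with [e1 x], and b(e1 x, y) stays nondegenerate
    on [U]. *)
Let b_proj x y : x \in U -> b (e1 x) (proj y) = 4 * b (e1 x) y.
Proof.
rewrite memU => /andP[/eqP Tx /eqP e2x].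
have e2E z : b (e1 x) (e2 z) = b (e1 x) z.
  by apply: oppr_inj; rewrite -e2_skew e21 e2x linearNl.
have TE z : b (e1 x) (e1 (e3 z)) = b (e1 x) z.
  have e3x : e3 x = - e1 x by rewrite -{2}Tx e11 opprK.
  by apply: oppr_inj; rewrite -e1_skew e11 linearNl -e3_skew e3x linearNl.
rewrite /proj !linearDr /= TE !linearDr /= !e2E; ring.
Qed.

Let e1_inj : injective e1.
Proof. by move=> x y /(congr1 e1); rewrite !e11 => /oppr_inj. Qed.

Let e4_inj : injective e4.
Proof. exact: can_inj e44. Qed.

Let e1_neq0 x : x != 0 -> e1 x != 0.
Proof. by rewrite -{2}(linear0 e1) (inj_eq e1_inj). Qed.

Let e4_neq0 x : x != 0 -> e4 x != 0.
Proof. by rewrite -{2}(linear0 e4) (inj_eq e4_inj). Qed.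

Let U_neq0 : exists2 u, u \in U & u != 0.
Proof.
have [x x0] : exists x : V, x != 0.
  by exists (vpick {:V}); rewrite vpick0 -dimv_eq0 -lt0n.
have [y e2y y0] : exists2 y, e2 y = y & y != 0.
  (* Either [x + e2 x] is a nonzero vector fixed by e2, or e2 x = - x and e1, which anticommutes
     with e2, carries [x] to one. *)
  have [|] := eqVneq (x + e2 x) 0; last first.
    by exists (x + e2 x); rewrite // linearD /= e22 addrC.
  move/eqP; rewrite addr_eq0 => /eqP e2x; exists (e1 x); last exact: e1_neq0.
  by rewrite {2}e2x linearN e21.
have [|] := eqVneq (y + e1 (e3 y)) 0; last first.
  exists (y + e1 (e3 y)) => //.
  by rewrite memU !linearD /= T13 C13 e2y addrC !eqxx.
move/eqP; rewrite addrC addr_eq0 => /eqP Ty.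
(* Now e1 e3 negates [y]; the product e1 e4 anticommutes with e1 e3 and commutes with e2, so it
   moves [y] into [U]. *)
exists (e1 (e4 y)); last by rewrite e1_neq0 ?e4_neq0.
have e3y : e3 y = e1 y by apply/oppr_inj; rewrite -e11 Ty linearN.
have e3z : e3 (e1 (e4 y)) = e1 (e4 (e3 y)) by rewrite e43 linearN e31.
have e2z : e2 (e1 (e4 y)) = e1 (e4 (e2 y)) by rewrite e42 linearN e21.
by rewrite memU e3z e2z e2y e3y e11 e41 opprK !eqxx.
Qed.

Let dimU : (2 <= \dim U)%N.
Proof.
have [x xU x0] := U_neq0.
have /mem_orthovPn[y _ bxy] : e1 x \notin orthov b fullv.
  by rewrite (eqP b_nondeg) memv0 e1_neq0.
have bpy : b (e1 x) (proj y) != 0 by rewrite b_proj // mulf_neq0 // pnatr_eq0.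
(* Here e1 is skew and [b] symmetric. Hence [proj y], which pairs nontrivially with [e1 x], is not a
   multiple of [x]. *)
have bxx : b (e1 x) x = 0.
  have := e1_skew x x; rewrite [b x _]hermC expr0 mul1r /= => /eqP.
  by rewrite -addr_eq0 -mulr2n mulrn_eq0 => /eqP.
have xpy : free [:: proj y; x].
  rewrite free_cons seq1_free x0 andbT span_seq1; apply: contra bpy.
  by case/vlineP=> k ->; rewrite linearZr_LR /= bxx mulr0.
rewrite -[2%N]/(size [:: proj y; x]) -(eqP xpy); apply/dimvS/span_subvP=> z.
by rewrite !inE => /orP[]/eqP->.
Qed.

(** Two doublings from dim U >= 2: e1 e4 exchanges the eigenspaces of e1 e3 inside the fixed space
    of e2, then e1 exchanges those of e2. The product e1 e4 is taken because e4 alone anticommutes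
    with e2. *)
Lemma skew_module_dim_geq8 : (8 <= \dim {:V})%N.
Proof.
have Wdim : (2 * \dim U <= \dim (fixedSpace e2))%N.
  apply: (@double_dim_leq _ (fixedSpace (- (e1 \o e3)%VF) :&: fixedSpace e2)%VS
            _ (e1 \o e4)%VF).
  - by move=> x y; rewrite !lfunE => /e1_inj/e4_inj.
  - exact: capvSr.
  - exact: capvSr.
  - exact: fixedSpace_capN.
  apply/subvP=> _ /memv_imgP[x + ->].
  rewrite memU memv_cap lfunE /= => /andP[/eqP Tx /eqP e2x].
  apply/andP; split; apply/fixedSpaceP; rewrite ?opp_lfunE ?lfunE /=.
    have e3x : e3 x = - e1 x by rewrite -{2}Tx e11 opprK.
    have e3z : e3 (e1 (e4 x)) = e1 (e4 (e3 x)) by rewrite e43 linearN e31.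
    by rewrite e3z e11 opprK e3x linearN /= e41 opprK.
  have e2z : e2 (e1 (e4 x)) = e1 (e4 (e2 x)) by rewrite e42 linearN e21.
  by rewrite e2z e2x.
have Vdim : (2 * \dim (fixedSpace e2) <= \dim {:V})%N.
  apply: (@double_dim_leq _ (fixedSpace (- e2)) _ e1) => //; rewrite ?subvf //.
    by have := fixedSpace_capN e2 fullv; rewrite !capvf.
  apply/subvP=> _ /memv_imgP[x /fixedSpaceP e2x ->]; apply/fixedSpaceP.
  by rewrite opp_lfunE e21 e2x opprK.
by have := dimU; lia.
Qed.

End CliffordDimension.

(** * Symmetric forms, subspaces and the universal property of the Clifford algebra *)

Lemma orthogonal_tuple_free (F : fieldType) (V : vectType F)
    (b : {symmetric V}) n (e : n.-tuple V) :
  (forall i j, i != j -> b (tnth e i) (tnth e j) = 0) ->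
  (forall i, b (tnth e i) (tnth e i) != 0) -> free e.
Proof.
move=> e_orth e_norm; apply/freeP=> k k0 i.
have := congr1 (fun x => b x (tnth e i)) k0.
rewrite linear0l linear_sumlz (bigD1 i) //= big1 => [|j ji].
  rewrite addr0 linearZl_LR /= -tnth_nth => /eqP.
  by rewrite mulf_eq0 (negPf (e_norm i)) orbF => /eqP.
by rewrite linearZl_LR /= -tnth_nth e_orth ?mulr0.
Qed.

Lemma clifford_lift (F : fieldType) (W : lmodType F) (q : W -> F)
    (V : vectType F) (J : {linear W -> 'End(V)}) :
    (forall z, (J z \o J z)%VF = (- q z) *: \1%VF) ->
  exists rho : {linear clifford q -> 'End(V)},
    clifford_module rho /\ forall z, rho (cl_gen q z) = J z.
Proof.
(* The witness is [cl_lift J_sqr], under its generated name as a linear map. *)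
move=> J_sqr; exists (Defs_cl_lift__canonical__GRing_Linear J_sqr).
by split; [apply: cl_lift_module | apply: cl_lift_gen].
Qed.

Lemma form_pythagoras (F : fieldType) (V : vectType F) (b : {symmetric V}) x y :
  b x y = 0 -> b (x + y) (x + y) = b x x + b y y.
Proof.
move=> bxy; have byx : b y x = 0 by rewrite hermC bxy mulr0.
by rewrite linearDl !linearDr /= bxy byx addr0 add0r.
Qed.

Lemma nondegenerateP (F : fieldType) (V : vectType F) (b : {symmetric V}) :
  (forall x, (forall y, b x y = 0) -> x = 0) -> nondegenerate b.
Proof.
move=> b0; rewrite /nondegenerate -subv0; apply/subvP=> x /mem_orthovP bx.
by rewrite memv0; apply/eqP/b0=> y; apply: bx; rewrite memvf.
Qed.

Section RestrictForm.
Variables (F : fieldType) (V : vectType F) (U : {vspace V}).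
Variable b : {symmetric V}.

(** Applied twice: from gl(6, C) to n_{-2} + n_{-1}, and from there to the Clifford module
    n_{-1}. *)
Definition restrict_form (x y : subvs_of U) : F := b (vsval x) (vsval y).

Fact restrict_form_bilinear :
  bilinear_for (GRing.Scale.Law.clone _ _ *%R _)
               (GRing.Scale.Law.clone _ _ *%R _) restrict_form.
Proof.
by split=> [y|x] a u v; rewrite /restrict_form linearP ?linearPl ?linearPr.
Qed.
HB.instance Definition _ := bilinear_isBilinear.Build F
  (subvs_of U) (subvs_of U) F _ _ restrict_form restrict_form_bilinear.

Fact restrict_form_sym x y :
  restrict_form x y = (-1) ^+ false * idfun (restrict_form y x).
Proof. exact: hermC. Qed.
HB.instance Definition _ := isHermitianSesquilinear.Build F
  (subvs_of U) false idfun restrict_form restrict_form_sym.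

End RestrictForm.

(** The inclusion into [L] is injective. Equality can fail, since [V] need not lie in [n2 + n1]. *)
Lemma dim_subv_in (F : fieldType) (L : lieAlg F) (n2 n1 : {vspace L})
  (h : {in n1 &, forall x y, lie_br x y \in n2})
  (h' : {in n2 & (n2 + n1)%VS, forall z x, lie_br z x = 0}) (V : {vspace L}) :
  (\dim (subv_in h h' V) <= \dim V)%N.
Proof.
pose f : 'Hom(subvs_of (n2 + n1), L) := linfun vsval.
have finj : injective f by move=> x y; rewrite !lfunE => /subvs_inj.
rewrite -(@limg_dim_eq _ _ _ f); last first.
  by have /lker0P/eqP-> := finj; rewrite capv0.
by apply/dimvS/subvP=> _ /memv_imgP[x + ->]; rewrite lfunE mem_subv_in.
Qed.

(** * From orthonormal vectors of signature (1,3) to the operator bound *)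

Section CliffordBound.
Variables (R : realFieldType) (W : lmodType R) (q : W -> R).

(** Expanding (z + w)^2 by the Clifford relation leaves the cross terms, which must cancel. As [q]
    is an arbitrary function, additivity stands for orthogonality. *)
Lemma cl_gen_anticomm (z w : W) : q (z + w) = q z + q w ->
  cl_gen q z * cl_gen q w = - (cl_gen q w * cl_gen q z).
Proof.
move=> qzw; apply/eqP; rewrite -addr_eq0; apply/eqP.
have := cl_gen_sqr q (z + w).
rewrite linearD mulrDl !mulrDr !cl_gen_sqr qzw opprD scalerDl.
rewrite -!addrA => /addrI; rewrite addrA addrC.
by rewrite -[RHS]addr0 => /addrI.
Qed.

(** Since z^2 = - q z, the positive vector [z1] acts with square -1 and the three negative ones act
    as involutions. *)
Lemma admissible_dim_geq8 (z1 z2 z3 z4 : W) (V : vectType R)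
    (rho : {linear clifford q -> 'End(V)}) :
    q z1 = 1 -> q z2 = -1 -> q z3 = -1 -> q z4 = -1 ->
    q (z2 + z1) = q z2 + q z1 -> q (z3 + z1) = q z3 + q z1 ->
    q (z4 + z1) = q z4 + q z1 -> q (z3 + z2) = q z3 + q z2 ->
    q (z4 + z2) = q z4 + q z2 -> q (z4 + z3) = q z4 + q z3 ->
  admissible rho -> (0 < \dim {:V})%N -> (8 <= \dim {:V})%N.
Proof.
move=> q1 q2 q3 q4 q21 q31 q41 q32 q42 q43 [rho_mod [b [b_nondeg b_skew]]] V0.
have sqr z x : rho (cl_gen q z) (rho (cl_gen q z) x) = (- q z) *: x.
  have /lfunP/(_ x) := clifford_module_gen_sqr z rho_mod.
  by rewrite !lfunE /= lfunE.
have anti z w x : q (z + w) = q z + q w ->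
    rho (cl_gen q z) (rho (cl_gen q w) x) =
    - rho (cl_gen q w) (rho (cl_gen q z) x).
  move=> /cl_gen_anticomm/(congr1 rho)/lfunP/(_ x).
  by case: rho_mod => _ rhoM; rewrite linearN opp_lfunE !rhoM !lfunE.
apply: (@skew_module_dim_geq8 _ _ b (rho (cl_gen q z1)) (rho (cl_gen q z2))
  (rho (cl_gen q z3)) (rho (cl_gen q z4))) => // x.
- by rewrite sqr q1 scaleN1r.
- by rewrite sqr q2 opprK scale1r.
- by rewrite sqr q3 opprK scale1r.
- by rewrite sqr q4 opprK scale1r.
all: exact: anti.
Qed.

End CliffordBound.

(** * Explicit coordinates, with indices from 0 to 5 where the overview counts from 1 to 6 *)

Local Notation "X @ [ k , l ]" := (X (inord k) (inord l))
  (at level 10, format "X @ [ k ,  l ]").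

Ltac complex_field :=
  apply/eqP; rewrite eq_complex /=; apply/andP; split; apply/eqP; by field.

Section Model.
Variable R : rcfType.
Local Notation C := R[i].
Local Notation gl6 := (gl R 6).

(* The element of n_{-1} with A = [a, b; c, d]: the condition defining su(3,3)
   forces the other block to be - s A^* s. *)
Definition low1 (a b c d : C) : gl6 := \matrix_(k, l)
  match val k, val l with
  | 2%N, 0%N => a | 2%N, 1%N => b | 3%N, 0%N => c | 3%N, 1%N => d
  | 4%N, 2%N => - d^* | 4%N, 3%N => - b^*
  | 5%N, 2%N => - c^* | 5%N, 3%N => - a^*
  | _, _ => 0
  end.

(* The element of n_{-2} with C = [x, i p; i q, - x^*]. *)
Definition low2 (x : C) (p q : R) : gl6 := \matrix_(k, l)
  match val k, val l with
  | 4%N, 0%N => x | 4%N, 1%N => 0 +i* p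
  | 5%N, 0%N => 0 +i* q | 5%N, 1%N => - x^*
  | _, _ => 0
  end.

Lemma low1_nneg a b c d : low1 a b c d \in nneg R 1.
Proof.
case: a b c d => [a a'] [b b'] [c c'] [d d'].
apply/nnegP => //; split=> k l; rewrite !mxE;
  case: k l => [[|[|[|[|[|[|k]]]]]] hk] [[|[|[|[|[|[|l]]]]]] hl] //=;
  complex_field.
Qed.

Lemma low2_nneg x p q : low2 x p q \in nneg R 2.
Proof.
case: x => x x'; apply/nnegP => //; split=> k l; rewrite !mxE;
  case: k l => [[|[|[|[|[|[|k]]]]]] hk] [[|[|[|[|[|[|l]]]]]] hl] //=;
  complex_field.
Qed.

Lemma nneg1E (X : gl6) : X \in nneg R 1 ->
  X = low1 (X @[2, 0]) (X @[2, 1]) (X @[3, 0]) (X @[3, 1]).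
Proof.
move=> /nnegP-/(_ isT)[X0 XE]; apply/matrixP=> k l; rewrite !mxE.
have XI (i j : 'I_6) : X i j = X @[i, j] by rewrite !inord_val.
have {}XE (i j : 'I_6) : X i j = - (X (rev_ord j) (rev_ord i))^*.
  by apply/eqP; rewrite -addr_eq0 XE.
case: k l => [[|[|[|[|[|[|k]]]]]] hk] [[|[|[|[|[|[|l]]]]]] hl] //=;
  lazymatch goal with
  | |- _ = 0 => exact: X0
  | |- _ = - _ => rewrite XE XI //
  | |- _ => rewrite XI //
  end.
Qed.

Lemma nneg2E (X : gl6) : X \in nneg R 2 ->
  X = low2 (X @[4, 0]) (complex.Im (X @[4, 1])) (complex.Im (X @[5, 0])).
Proof.
move=> /nnegP-/(_ isT)[X0 XE]; apply/matrixP=> k l; rewrite !mxE.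
have XI (i j : 'I_6) : X i j = X @[i, j] by rewrite !inord_val.
(* An antidiagonal entry is its own partner under the su(3,3) condition, hence purely imaginary. *)
have Xim (i : 'I_6) : X i (rev_ord i) = 0 +i* complex.Im (X i (rev_ord i)).
  have := XE i (rev_ord i); rewrite rev_ordK.
  case: (X i (rev_ord i)) => x y /eqP; rewrite eq_complex /= => /andP[+ _].
  by rewrite -mulr2n mulrn_eq0 => /eqP->.
have {}XE (i j : 'I_6) : X i j = - (X (rev_ord j) (rev_ord i))^*.
  by apply/eqP; rewrite -addr_eq0 XE.
case: k l => [[|[|[|[|[|[|k]]]]]] hk] [[|[|[|[|[|[|l]]]]]] hl] //=;
  lazymatch goal with
  | |- _ = 0 => exact: X0
  | |- _ = - _ => rewrite XE XI //
  | |- _ => rewrite XI //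
  end.
- by have := Xim (Ordinal hk); rewrite XI.
- by have := Xim (Ordinal hk); rewrite XI.
Qed.

Lemma low1_linear k a b c d a' b' c' d' :
  k *: low1 a b c d + low1 a' b' c' d' = low1 (k%:C * a + a') (k%:C * b + b')
    (k%:C * c + c') (k%:C * d + d') :> gl6.
Proof.
case: a a' b b' c c' d d' => [? ?] [? ?] [? ?] [? ?] [? ?] [? ?] [? ?] [? ?].
rewrite realmx_scaleE; apply/matrixP=> i j; rewrite !mxE.
by case: i j => [[|[|[|[|[|[|i]]]]]] hi] [[|[|[|[|[|[|j]]]]]] hj] //=;
  complex_field.
Qed.

Lemma low1_0 : low1 0 0 0 0 = 0 :> gl6.
Proof.
apply/matrixP=> i j; rewrite !mxE.
by case: i j => [[|[|[|[|[|[|i]]]]]] hi] [[|[|[|[|[|[|j]]]]]] hj] //=;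
  complex_field.
Qed.

(* The polarisation of 2 Re (det A) on n_{-1} and of det C on n_{-2}. *)
Definition su_form (X Y : gl6) : R :=
  complex.Re (X @[2, 0] * Y @[3, 1] + Y @[2, 0] * X @[3, 1]
              - X @[2, 1] * Y @[3, 0] - Y @[2, 1] * X @[3, 0])
  + complex.Re (X @[4, 0] * Y @[5, 1] + Y @[4, 0] * X @[5, 1]
                - X @[4, 1] * Y @[5, 0] - Y @[4, 1] * X @[5, 0]) / 2.

Lemma su_formC X Y : su_form X Y = su_form Y X.
Proof.
rewrite /su_form; congr (complex.Re _ + complex.Re _ / 2); ring.
Qed.

Fact su_form_bilinear :
  bilinear_for (GRing.Scale.Law.clone _ _ *%R _)
               (GRing.Scale.Law.clone _ _ *%R _) su_form.
Proof.
have lin Y : linear_for *%R (su_form^~ Y).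
  move=> k X X'; rewrite /su_form realmx_scaleE !mxE.
  have ReP (u v : C) :
      complex.Re (k%:C * u + v) = k * complex.Re u + complex.Re v.
    by case: u v => [? ?] [? ?] /=; ring.
  rewrite [in RHS]mulrDr [in RHS]mulrA [RHS]addrACA -mulrDl -!ReP.
  congr (complex.Re _ + complex.Re _ / 2); ring.
split=> [Y|X]; first exact: lin.
by move=> k Y Y'; rewrite !(su_formC X) lin.
Qed.
HB.instance Definition _ := bilinear_isBilinear.Build R gl6 gl6 R _ _
  su_form su_form_bilinear.

Fact su_form_sym X Y : su_form X Y = (-1) ^+ false * idfun (su_form Y X).
Proof. by rewrite expr0 mul1r su_formC. Qed.
HB.instance Definition _ :=
  isHermitianSesquilinear.Build R gl6 false idfun su_form su_form_sym.

Lemma su_form11 a b c d a' b' c' d' :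
  su_form (low1 a b c d) (low1 a' b' c' d') =
  complex.Re (a * d' + a' * d - b * c' - b' * c).
Proof.
by rewrite /su_form !mxE /= !inordK //= ?(mulr0, mul0r, addr0, subr0).
Qed.

(** For equal arguments this is p q - |x|^2, the determinant of C, which makes the signature (1,3)
    visible. *)
Lemma su_form22 x p q x' p' q' :
  su_form (low2 x p q) (low2 x' p' q') =
  (p * q' + p' * q) / 2 - complex.Re (x * x'^*).
Proof.
by rewrite /su_form !mxE /= !inordK //=; case: x x' => [? ?] [? ?] /=; field.
Qed.

Lemma su_form21 x p q a b c d : su_form (low2 x p q) (low1 a b c d) = 0.
Proof.
by rewrite /su_form !mxE /= !inordK //= ?(mulr0, mul0r, addr0, subr0).
Qed.

Lemma br_low1 a b c d a' b' c' d' :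
  comm_br (low1 a b c d) (low1 a' b' c' d') =
  low2 (d'^* * a + b'^* * c - d^* * a' - b^* * c')
    (complex.Im (d'^* * b + b'^* * d - d^* * b' - b^* * d'))
    (complex.Im (c'^* * a + a'^* * c - c^* * a' - a^* * c')) :> gl6.
Proof.
(* The bracket lies in n_{-2}, so three of its entries determine it. *)
rewrite [LHS]nneg2E; last by apply: nneg_br; apply: low1_nneg.
have brE (X Y : gl6) k l : comm_br X Y k l =
    \sum_m X k m * Y m l - \sum_m Y k m * X m l :> C.
  by rewrite [LHS]mxE [X in _ + X]mxE !mxE.
rewrite !brE !big_ord_recr !big_ord0 !mxE /= !inordK //=.
congr (low2 _ (complex.Im _) (complex.Im _)); ring.
Qed.

(** The matrix formula of the overview, entry by entry. [low1] supplies the other block, so the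
    value lies in n_{-1} for all arguments. *)
Definition su_J (Z X : gl6) : gl6 :=
  low1 (X @[2, 0] * Z @[5, 1] - X @[2, 1] * Z @[5, 0])^*
       (X @[2, 0] * Z @[4, 1] - X @[2, 1] * Z @[4, 0])^*
       (X @[3, 1] * Z @[5, 0] - X @[3, 0] * Z @[5, 1])^*
       (X @[3, 1] * Z @[4, 0] - X @[3, 0] * Z @[4, 1])^*.

Lemma su_J_low x p q a b c d : su_J (low2 x p q) (low1 a b c d) =
  low1 (- (a * x^*) - b * (0 +i* q))^* (a * (0 +i* p) - b * x)^*
       (d * (0 +i* q) + c * x^*)^* (d * x - c * (0 +i* p))^*.
Proof.
rewrite /su_J !mxE /= !inordK //=.
by congr (low1 _^* _^* _^* _^*); ring.
Qed.

Lemma conjc_linear k (u v : C) : (k%:C * u + v)^* = k%:C * u^* + v^*.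
Proof. by case: u v => [? ?] [? ?]; complex_field. Qed.

Lemma su_J_linearr Z : linear (su_J Z).
Proof.
move=> k X X'; rewrite /su_J low1_linear realmx_scaleE !mxE.
by rewrite -!conjc_linear; congr (low1 _^* _^* _^* _^*); ring.
Qed.

Lemma su_J_linearl X : linear (su_J^~ X).
Proof.
move=> k Z Z'; rewrite /su_J low1_linear realmx_scaleE !mxE.
by rewrite -!conjc_linear; congr (low1 _^* _^* _^* _^*); ring.
Qed.

Lemma su_J_adjoint (Z X Y : gl6) :
    Z \in nneg R 2 -> X \in nneg R 1 -> Y \in nneg R 1 ->
  su_form (su_J Z X) Y = su_form (comm_br X Y) Z.
Proof.
move=> /nneg2E-> /nneg1E-> /nneg1E->.
rewrite su_J_low br_low1 su_form11 su_form22.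
move: (X @[2, 0]) (X @[2, 1]) (X @[3, 0]) (X @[3, 1]).
move: (Y @[2, 0]) (Y @[2, 1]) (Y @[3, 0]) (Y @[3, 1]).
move: (Z @[4, 0]) => [? ?] [? ?] [? ?] [? ?] [? ?] [? ?] [? ?] [? ?] [? ?] /=.
by field.
Qed.

(** Behind the computation: with M = [c22, c12; - c21, - c11], J_Z^2 sends A to A M conj(M), as tau
    is real of square 1; the shape of C gives M conj(M) = - det C. *)
Lemma su_J_sqr (Z X : gl6) : Z \in nneg R 2 -> X \in nneg R 1 ->
  su_J Z (su_J Z X) = (- su_form Z Z) *: X.
Proof.
move=> /nneg2E-> /nneg1E->; rewrite !su_J_low su_form22.
move: (X @[2, 0]) (X @[2, 1]) (X @[3, 0]) (X @[3, 1]).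
move: (Z @[4, 0]) => [? ?] [? ?] [? ?] [? ?] [? ?] /=.
(* Adding zero as a [low1] makes [low1_linear] applicable to a bare scalar multiple. *)
rewrite -[RHS]addr0 -low1_0 low1_linear; congr (low1 _ _ _ _);
  complex_field.
Qed.

Lemma low1_eq0 (a b c d : R[i]) :
  complex.Re (a * a^* + d^* * d + b * b^* + c^* * c) = 0 ->
  low1 a b c d = 0 :> gl6.
Proof.
case: a b c d => [a a'] [b b'] [c c'] [d d'] /= s0; rewrite -low1_0.
have {s0}/eqP : a ^+ 2 + a' ^+ 2 + (b ^+ 2 + b' ^+ 2)
    + (c ^+ 2 + c' ^+ 2) + (d ^+ 2 + d' ^+ 2) = 0 by rewrite -s0; ring.
rewrite !paddr_eq0 ?addr_ge0 ?sqr_ge0 // !sqrf_eq0.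
case/andP=> /andP[/andP[/andP[/eqP-> /eqP->] /andP[/eqP-> /eqP->]]].
by case/andP=> /eqP-> /eqP-> /andP[/eqP-> /eqP->].
Qed.

Lemma low2_0 : low2 0 0 0 = 0 :> gl6.
Proof.
apply/matrixP=> i j; rewrite !mxE.
by case: i j => [[|[|[|[|[|[|i]]]]]] hi] [[|[|[|[|[|[|j]]]]]] hj] //=;
  complex_field.
Qed.

Lemma su_form_nondeg1 (X : gl6) : X \in nneg R 1 ->
  (forall Y, Y \in nneg R 1 -> su_form X Y = 0) -> X = 0.
Proof.
(* The witness has as block the conjugate cofactor matrix of A; pairing with it gives the sum of the
   squared moduli of the entries of A. *)
move=> /nneg1E-> X0; apply: low1_eq0; rewrite -[RHS](X0 _ (low1_nneg
  (X @[3, 1])^* (- (X @[3, 0])^*) (- (X @[2, 1])^*) (X @[2, 0])^*)) su_form11.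
congr (complex.Re _); ring.
Qed.

Lemma su_form_nondeg2 (X : gl6) : X \in nneg R 2 ->
  (forall Y, Y \in nneg R 2 -> su_form X Y = 0) -> X = 0.
Proof.
move=> /nneg2E-> X0; move: X0.
move: (X @[4, 0]) (complex.Im _) (complex.Im _) => [x x'] q p X0.
(* Swapping p and q and negating x turns the form into a positive definite one. *)
have := X0 _ (low2_nneg (- (x +i* x')) q p); rewrite su_form22 /= => s0.
have {s0}/eqP : (p ^+ 2 + q ^+ 2) / 2 + (x ^+ 2 + x' ^+ 2) = 0.
  by rewrite -s0; field.
rewrite !paddr_eq0 ?addr_ge0 ?divr_ge0 ?addr_ge0 ?sqr_ge0 ?ler0n //.
rewrite mulf_eq0 invr_eq0 pnatr_eq0 orbF.
rewrite !paddr_eq0 ?sqr_ge0 // !sqrf_eq0.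
by case/andP=> /andP[/eqP-> /eqP->] /andP[/eqP-> /eqP->]; apply: low2_0.
Qed.

Lemma su_form_orth (Z X : gl6) :
  Z \in nneg R 2 -> X \in nneg R 1 -> su_form Z X = 0.
Proof. by move=> /nneg2E-> /nneg1E->; apply: su_form21. Qed.

(** By [nneg1E] the real and imaginary parts of the four entries of A are eight real coordinates
    that determine the element. *)
Lemma dim_nneg1 : (\dim (nneg R 1) <= 8)%N.
Proof.
pose s (X : gl6) : seq R := [:: complex.Re (X @[2, 0]); complex.Im (X @[2, 0]);
  complex.Re (X @[2, 1]); complex.Im (X @[2, 1]); complex.Re (X @[3, 0]);
  complex.Im (X @[3, 0]); complex.Re (X @[3, 1]); complex.Im (X @[3, 1])].
pose f (X : gl6) : 'rV[R]_8 := \row_j (s X)`_j.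
have f_lin : linear f.
  move=> k X Y; apply/matrixP=> i j; rewrite !mxE /s realmx_scaleE !mxE.
  move: (X @[2, 0]) (X @[2, 1]) (X @[3, 0]) (X @[3, 1]).
  move: (Y @[2, 0]) (Y @[2, 1]) (Y @[3, 0]) (Y @[3, 1]) =>
    [? ?] [? ?] [? ?] [? ?] [? ?] [? ?] [? ?] [? ?] /=.
  by case: j => [[|[|[|[|[|[|[|[|j]]]]]]]] hj] //=; ring.
pose F := GRing.isLinear.Build _ _ _ _ f f_lin.
pose fl : {linear gl6 -> 'rV[R]_8} := HB.pack f F.
have -> : 8%N = \dim {:'rV[R]_8} by rewrite dimvf /dim /= mul1n.
rewrite -(@limg_dim_eq _ _ _ (linfun fl)); first exact/dimvS/subvf.
apply/eqP; rewrite -subv0; apply/subvP=> X; rewrite memv_cap memv_ker lfunE /=.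
case/andP=> Xn /eqP/rowP f0; rewrite memv0 (nneg1E Xn).
have sn j : (j < 8)%N -> (s X)`_j = 0.
  by move=> hj; have := f0 (Ordinal hj); rewrite !mxE.
have E (u : R[i]) : complex.Re u = 0 -> complex.Im u = 0 -> u = 0.
  by case: u => u u' /= -> ->.
rewrite (E (X @[2, 0]) (sn 0%N isT) (sn 1%N isT)).
rewrite (E (X @[2, 1]) (sn 2%N isT) (sn 3%N isT)).
rewrite (E (X @[3, 0]) (sn 4%N isT) (sn 5%N isT)).
by rewrite (E (X @[3, 1]) (sn 6%N isT) (sn 7%N isT)) low1_0.
Qed.

(** The blocks C are i sigma_x, - sigma_y, sigma_z and i Id, of determinants 1, -1, -1, -1: an
    orthonormal basis for the determinant form. *)
Definition pauli : 4.-tuple gl6 :=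
  [tuple low2 0 1 1; low2 0 1 (-1); low2 1 0 0; low2 (0 +i* 1) 0 0].

Definition minkowski_diag : 4.-tuple R := [tuple 1; -1; -1; -1].

Lemma pauli_nneg i : tnth pauli i \in nneg R 2.
Proof.
by case: i => [[|[|[|[|i]]]] hi] //; rewrite (tnth_nth 0); apply: low2_nneg.
Qed.

Lemma su_form_pauli i j :
  su_form (tnth pauli i) (tnth pauli j) = tnth minkowski_diag i *+ (i == j).
Proof.
rewrite !(tnth_nth 0); case: i j => [[|[|[|[|i]]]] hi] [[|[|[|[|j]]]] hj] //;
  by rewrite su_form22 /=; field.
Qed.

Lemma pauli_span (X : gl6) : X \in nneg R 2 -> X \in <<pauli>>%VS.
Proof.
move=> /nneg2E->.
move: (X @[4, 0]) (complex.Im _) (complex.Im _) => [x x'] q p.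
have -> : low2 (x +i* x') p q = ((p + q) / 2) *: low2 0 1 1
    + ((p - q) / 2) *: low2 0 1 (-1) + x *: low2 1 0 0
    + x' *: low2 (0 +i* 1) 0 0 :> gl6.
  rewrite !realmx_scaleE; apply/matrixP=> i j; rewrite !mxE.
  by case: i j => [[|[|[|[|[|[|i]]]]]] hi] [[|[|[|[|[|[|j]]]]]] hj] //=;
    complex_field.
by rewrite !memvD ?memvZ ?memv_span // !inE eqxx ?orbT.
Qed.

End Model.

(** * Transport to the graded Lie algebra, signature and minimality *)

Section Assembly.
Variable R : rcfType.
Local Notation gl6 := (gl R 6).
Local Notation L := (su33_neg R).
Local Notation U := (nneg R 2 + nneg R 1)%VS.
Local Notation val_gl x := (vsval (x : subvs_of U) : gl6).

Lemma mem_gr2 (x : L) : (x \in gr2 L) = (val_gl x \in nneg R 2).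
Proof.
exact: (@mem_subv_in _ _ _ _ (@nneg_br R) (@nneg_central R) (nneg R 2)).
Qed.

Lemma mem_gr1 (x : L) : (x \in gr1 L) = (val_gl x \in nneg R 1).
Proof.
exact: (@mem_subv_in _ _ _ _ (@nneg_br R) (@nneg_central R) (nneg R 1)).
Qed.

Lemma val_lie_br (x y : L) :
  val_gl (lie_br x y) = comm_br (val_gl x) (val_gl y).
Proof. exact: (sub_brE (@nneg_br R) (@nneg_central R)). Qed.

Definition in_L (X : gl6) : L := vsproj U X.

Lemma in_L2K X : X \in nneg R 2 -> val_gl (in_L X) = X.
Proof. by move=> X2; apply: vsprojK; apply: (subvP (addvSl _ _)). Qed.

Lemma in_L1K X : X \in nneg R 1 -> val_gl (in_L X) = X.
Proof. by move=> X1; apply: vsprojK; apply: (subvP (addvSr _ _)). Qed.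

Definition su_neg_form : {symmetric L} :=
  restrict_form (U := U) (@su_form R).

Lemma su_neg_formC (x y : L) : su_neg_form x y = su_neg_form y x.
Proof. exact: su_formC. Qed.

Lemma su_neg_form_orth (z x : L) : z \in gr2 L -> x \in gr1 L ->
  su_neg_form z x = 0.
Proof. by rewrite mem_gr2 mem_gr1; apply: su_form_orth. Qed.

Lemma su_neg_form_nondeg2 (z : L) : z \in gr2 L ->
  (forall w, w \in gr2 L -> su_neg_form z w = 0) -> z = 0.
Proof.
rewrite mem_gr2 => z2 z0; apply/val_inj/su_form_nondeg2 => // Y Y2.
by rewrite -(in_L2K Y2); apply: z0; rewrite mem_gr2 in_L2K.
Qed.

Lemma su_neg_form_nondeg1 (x : L) : x \in gr1 L ->
  (forall y, y \in gr1 L -> su_neg_form x y = 0) -> x = 0.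
Proof.
rewrite mem_gr1 => x1 x0; apply/val_inj/su_form_nondeg1 => // Y Y1.
by rewrite -(in_L1K Y1); apply: x0; rewrite mem_gr1 in_L1K.
Qed.

(** The graded pieces are orthogonal and the form is nondegenerate on each, so both components of a
    vector in the radical vanish. *)
Lemma su_neg_form_nondeg : nondegenerate su_neg_form.
Proof.
apply: nondegenerateP => x x0.
have /memv_addP[z z2 [y y1 xE]] : x \in (gr2 L + gr1 L)%VS.
  by rewrite gr_sum memvf.
have zy w : su_neg_form z w + su_neg_form y w = 0.
  by rewrite -[RHS](x0 w) xE [RHS]linearDl.
rewrite xE.
have -> : z = 0.
  apply: su_neg_form_nondeg2 => // w w2.
  by rewrite -[RHS](zy w) (su_neg_formC y) (su_neg_form_orth w2 y1) addr0.
have -> : y = 0.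
  apply: su_neg_form_nondeg1 => // w w1.
  by rewrite -[RHS](zy w) (su_neg_form_orth z2 w1) add0r.
by rewrite addr0.
Qed.

Definition su_neg_Jfun (z : subvs_of (gr2 L)) (x : subvs_of (gr1 L)) :
    subvs_of (gr1 L) :=
  vsproj (gr1 L) (in_L (su_J (val_gl (vsval z)) (val_gl (vsval x)))).

Lemma su_neg_JfunE z x : val_gl (vsval (su_neg_Jfun z x)) =
  su_J (val_gl (vsval z)) (val_gl (vsval x)).
Proof. by rewrite vsprojK ?mem_gr1 in_L1K ?low1_nneg. Qed.

Fact su_neg_Jfun_linear z : linear (su_neg_Jfun z).
Proof.
(* Two injections, as n_{-1} is a subspace of [L], itself a subspace of gl(6, C). *)
move=> k x y; do 2!apply/val_inj; rewrite /= su_neg_JfunE.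
by rewrite !linearP /= !su_neg_JfunE su_J_linearr.
Qed.
HB.instance Definition _ z := GRing.isLinear.Build R
  (subvs_of (gr1 L)) (subvs_of (gr1 L)) _ (su_neg_Jfun z)
  (su_neg_Jfun_linear z).

Definition su_neg_J (z : subvs_of (gr2 L)) : 'End(subvs_of (gr1 L)) :=
  linfun (su_neg_Jfun z).

Lemma su_neg_JE z x : val_gl (vsval (su_neg_J z x)) =
  su_J (val_gl (vsval z)) (val_gl (vsval x)).
Proof. by rewrite lfunE su_neg_JfunE. Qed.

Fact su_neg_J_linear : linear su_neg_J.
Proof.
move=> k z w; apply/lfunP=> x; do 2!apply/val_inj.
rewrite /= su_neg_JE add_lfunE scale_lfunE !linearP /=.
by rewrite su_J_linearl !su_neg_JE.
Qed.
HB.instance Definition _ := GRing.isLinear.Build R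
  (subvs_of (gr2 L)) 'End(subvs_of (gr1 L)) _ su_neg_J su_neg_J_linear.

Lemma su_neg_J_def (z : subvs_of (gr2 L)) (x y : subvs_of (gr1 L)) :
  su_neg_form (vsval (su_neg_J z x)) (vsval y) =
  su_neg_form (lie_br (vsval x) (vsval y)) (vsval z).
Proof.
rewrite /= /restrict_form su_neg_JE val_lie_br.
by apply: su_J_adjoint; rewrite -?mem_gr1 -?mem_gr2 subvsP.
Qed.

Lemma su_neg_J_sqr (z : subvs_of (gr2 L)) : (su_neg_J z \o su_neg_J z)%VF =
  (- su_neg_form (vsval z) (vsval z)) *: \1%VF.
Proof.
apply/lfunP=> x; do 2!apply/val_inj.
rewrite /= lfunE /= !su_neg_JE su_J_sqr; last 2 first.
- by rewrite -mem_gr2 subvsP.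
- by rewrite -mem_gr1 subvsP.
by rewrite scale_lfunE id_lfunE !linearZ.
Qed.

Definition su_neg_pseudoH : pseudoH R :=
  PseudoH su_neg_form_nondeg su_neg_form_orth su_neg_form_nondeg2
    su_neg_J_def su_neg_J_sqr.

Local Notation N := su_neg_pseudoH.

Definition pauli_neg : 4.-tuple L := map_tuple in_L (pauli R).

Lemma tnth_pauli_neg i : val_gl (tnth pauli_neg i) = tnth (pauli R) i.
Proof. by rewrite tnth_map in_L2K ?pauli_nneg. Qed.

Lemma su_neg_form_pauli i j :
  su_neg_form (tnth pauli_neg i) (tnth pauli_neg j) =
  tnth (minkowski_diag R) i *+ (i == j).
Proof. by rewrite /= /restrict_form !tnth_pauli_neg su_form_pauli. Qed.

Lemma tnth_pauli_gr2 i : tnth pauli_neg i \in gr2 L.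
Proof. by rewrite mem_gr2 tnth_pauli_neg pauli_nneg. Qed.

Lemma minkowski_diag_neq0 i : tnth (minkowski_diag R) i != 0.
Proof.
by case: i => [[|[|[|[|i]]]] hi] //; rewrite (tnth_nth 0) /= ?oppr_eq0 oner_eq0.
Qed.

Lemma pauli_neg_basis : basis_of (gr2 L) pauli_neg.
Proof.
apply/andP; split.
  rewrite eqEsubv; apply/andP; split.
    by apply/span_subvP=> _ /tnthP[i ->]; apply: tnth_pauli_gr2.
  apply/subvP=> z; rewrite mem_gr2 => /pauli_span/coord_span zE.
  have -> : z = \sum_i coord (pauli R) i (val_gl z) *: tnth pauli_neg i.
    apply/(@subvs_inj _ _ U); rewrite [LHS]zE linear_sum; apply: eq_bigr => i _.
    rewrite [RHS]linearZ; congr (_ *: _).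
    by rewrite [RHS]tnth_pauli_neg -tnth_nth.
  by apply: memv_suml => i _; rewrite memvZ ?memv_span ?mem_tnth.
by apply: (@orthogonal_tuple_free _ _ su_neg_form) => [i j ij|i];
  rewrite su_neg_form_pauli ?(negPf ij) ?eqxx ?minkowski_diag_neq0.
Qed.

Lemma su_neg_signature : has_signature (gr2 L) su_neg_form 1 3.
Proof.
exists 4, pauli_neg, (minkowski_diag R); split; first exact: pauli_neg_basis.
(* The Gram matrix is diagonal, hence triangular, and its eigenvalues can be read off. *)
- rewrite char_poly_trig.
    rewrite big_tuple; apply: eq_bigr => i _.
    by rewrite mxE su_neg_form_pauli eqxx.
  apply/is_diag_mx_is_trig/is_diag_mxP=> i j ij.
  by rewrite mxE su_neg_form_pauli -val_eqE (negPf ij).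
- by rewrite /= ltr01 !oppr_gt0 !ltr10.
- by rewrite /= ltrN10 ltr10.
Qed.

Local Notation qN :=
  (fun z : subvs_of (gr2 N) => ph_form N (vsval z) (vsval z)).

Lemma su_neg_minimal :
  exists rho : {linear clifford qN -> 'End(subvs_of (gr1 N))},
    (forall z, rho (cl_gen qN z) = ph_J z) /\ minimal_admissible rho.
Proof.
have [rho [rho_mod rho_gen]] := clifford_lift (q := qN) su_neg_J_sqr.
exists rho; split; first exact: rho_gen.
split.
- split=> //.
  exists (restrict_form (U := gr1 L) su_neg_form); split.
    apply: nondegenerateP => x x0; apply/val_inj.
    apply: su_neg_form_nondeg1 => [|y y1]; first exact: subvsP.
    by have := x0 (Subvs y1).
  (* Skewness of J_z is the antisymmetry of the bracket, through the defining identity of J_z. *)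
  move=> z x y; rewrite !rho_gen /=; apply: etrans (su_neg_J_def z x y) _.
  rewrite lie_anti; apply: etrans (linearNl _ _ _) _; congr (- _).
  by apply: etrans (su_neg_formC _ _); rewrite su_neg_J_def.
(* If n_{-1} were zero, its brackets would all vanish. *)
- rewrite lt0n dimv_eq0; apply/eqP=> V0.
  have [X [Y [X1 Y1]]] := nneg_nonabelian R; case/negP.
  have Xgr : in_L X \in gr1 L by rewrite mem_gr1 in_L1K.
  have : Subvs Xgr \in (0 : {vspace subvs_of (gr1 L)})%VS by rewrite -V0 memvf.
  rewrite memv0 => /eqP/congr_subvs/congr_subvs /=; rewrite in_L1K // => ->.
  by rewrite linear0l.
(* The number 8 separates: it bounds n_{-1} from above and every nonzero admissible module from
   below. *)
move=> V rho' adm V_gt0; apply: (@leq_trans 8).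
  rewrite dimvf; apply: leq_trans (dim_nneg1 R).
  exact: (dim_subv_in (@nneg_br R) (@nneg_central R) (nneg R 1)).
pose z i : subvs_of (gr2 N) := Subvs (tnth_pauli_gr2 i).
have qE i : qN (z i) = tnth (minkowski_diag R) i.
  by rewrite /= [LHS]su_neg_form_pauli eqxx.
have qD i j : i != j -> qN (z i + z j) = qN (z i) + qN (z j).
  move=> ij; apply: (form_pythagoras (b := su_neg_form)).
  by rewrite su_neg_form_pauli (negPf ij).
apply: (@admissible_dim_geq8 _ _ _ (z 0) (z 1) (z 2) (z 3)) adm V_gt0;
  by rewrite ?qD // qE (tnth_nth 0).
Qed.

(** [N] only adds a form and the maps J_z to [L], so the identity is an isomorphism. *)
Lemma su_neg_iso : graded_iso L N.
Proof.
exists \1%VF; split.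
- by exists id => x; rewrite id_lfunE.
- by move=> x y; rewrite !id_lfunE.
- exact: lim1g.
- exact: lim1g.
Qed.

End Assembly.

Theorem theorem8 (R : realType) :
  exists N : pseudoH R, is_n_rs N 1 3 /\ graded_iso (su33_neg R) N.
Proof.
exists (su_neg_pseudoH R); split; last exact: su_neg_iso.
by split; [apply: su_neg_signature | apply: su_neg_minimal].
Qed.
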